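(* Let $q$ be a prime and let $k>4$ be an integer such that $k+1$ is prime and $q$ is a primitive root modulo $k+1$. Let $d$ be the largest prime strictly smaller than $\sqrt{k}$, and let $A=\{a_1,\dots,a_d\}$ be a Bose–Chowla Sidon set of order $d$. Define $\alpha^*=\sum_{a\in A}x^a\in\mathbb{F}_{q^k}$. Then the minimum distance of the Wozencraft ensemble code $C^{\alpha^*}_{\mathrm{WE}}$ satisfies $$\Delta(C^{\alpha^*}_{\mathrm{WE}})\ \ge\ \frac d2\ =\ \Omega(\sqrt{k}),$$ where $\frac d2=\Omega(\sqrt k)$ means that there is an absolute constant $c_0>0$ with $\frac d2\ge c_0\sqrt{k}$ for all such $k$.
   Context: Representation of $\mathbb{F}_{q^k}$: put $k'=k+1$ and $p(x)=1+x+x^2+\cdots+x^{k'-1}\in\mathbb{F}_q[x]$. Since $k'$ is prime and $q$ is a primitive root modulo $k'$, $p$ is irreducible of degree $k$ over $\mathbb{F}_q$, and $\mathbb{F}_{q^k}$ is represented as $\mathbb{F}_q[x]/(p(x))$, i.e. as polynomials in $x$ of degree less than $k$ with operations modulo $p(x)$. Let $\varphi:\mathbb{F}_{q^k}\to\mathbb{F}_q^k$ be the $\mathbb{F}_q$-linear isomorphism $\varphi(\sum_{i=0}^{k-1}a_ix^i)=(a_0,\dots,a_{k-1})$. Wozencraft ensemble code: for $\alpha\in\mathbb{F}_{q^k}$, $C^{\alpha}_{\mathrm{WE}}=\{(\varphi(y),\varphi(\alpha y)) : y\in\mathbb{F}_{q^k}\}\subseteq\mathbb{F}_q^{2k}$,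 where the product $\alpha y$ is taken in $\mathbb{F}_{q^k}$. It is an $\mathbb{F}_q$-linear code of rate $1/2$. $\Delta(C)$ denotes the minimum (Hamming) distance of a code $C$. Bose–Chowla Sidon set of order $d$ ($d$ prime): for a primitive element $\theta$ of $\mathbb{F}_{d^2}$ (a generator of $\mathbb{F}_{d^2}^*$), the set $A=\{a\in\mathbb{Z} : 1\le a<d^2,\ \theta^a-\theta\in\mathbb{F}_d\}$. It is a known theorem (Bose–Chowla) that $A$ has exactly $d$ elements and is a Sidon set modulo $d^2-1$, meaning: for $a,b,a',b'\in A$ with $a\ne b$ and $a'\neq b'$, $a-b\equiv a'-b'\pmod{d^2-1}$ if and only if $a=a'$ and $b=b'$. *)

(* Defs.v *)
From HB Require Import structures.
From mathcomp Require Import all_boot all_order all_algebra all_fingroup.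
From mathcomp Require Import all_solvable all_field.
From mathcomp Require Import reals.
Set Implicit Arguments.
Unset Strict Implicit.
Unset Printing Implicit Defensive.
Import Order.TTheory GRing.Theory Num.Theory.
Local Open Scope ring_scope.

Definition hamming_dist (T : eqType) (n : nat) (u v : 'rV[T]_n) : nat :=
  #|[set i : 'I_n | u ord0 i != v ord0 i]|.

(* Distances are at most n, so the default value n only matters when C has
   fewer than two elements (see min_distP). *)
Definition min_dist (T : finType) (n : nat) (C : {set 'rV[T]_n}) : nat :=
  \big[minn/n]_(uv in setX C C | uv.1 != uv.2) hamming_dist uv.1 uv.2.

Lemma min_distP (T : finType) (n : nat) (C : {set 'rV[T]_n}) :
  (1 < #|C|)%N ->
  (exists u v, [/\ u \in C, v \in C, u != v
                 & min_dist C = hamming_dist u v]) /\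
  (forall u v, u \in C -> v \in C -> u != v ->
     (min_dist C <= hamming_dist u v)%N).
Proof.
have lb (u v : 'rV[T]_n) : u \in C -> v \in C -> u != v ->
    (min_dist C <= hamming_dist u v)%N.
  move=> uC vC uv; rewrite /min_dist.
  have: (u, v) \in index_enum ('rV[T]_n * 'rV[T]_n)%type.
    by rewrite mem_index_enum.
  elim: (index_enum _) => // p r IH; rewrite in_cons big_cons.
  case/predU1P=> [<-|/IH le_r].
    by rewrite in_setX uC vC uv /= geq_minl.
  by case: ifP => // _; rewrite geq_min le_r orbT.
move=> /card_gt1P[u [v [uC vC uv]]]; split=> //.
have [m_eq|//] : min_dist C = n \/ exists u v, [/\ u \in C, v \in C, u != v
    & min_dist C = hamming_dist u v].
  rewrite {1 2}/min_dist; elim/big_ind: _ => [|m1 m2 H1 H2|[x y]].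
  - by left.
  - by rewrite /minn; case: ifP.
  - by rewrite in_setX /= => /andP[/andP[xC yC] xy]; right; exists x, y.
exists u, v; split=> //; apply/eqP; rewrite eqn_leq lb //= m_eq.
by rewrite -[leqRHS]card_ord max_card.
Qed.

Definition all_one_poly (q k : nat) : {poly 'F_q} := \sum_(i < k.+1) 'X^i.

Lemma all_one_polyE (q k : nat) : all_one_poly q k = \poly_(i < k.+1) 1.
Proof. by rewrite poly_def; apply: eq_bigr => i _; rewrite scale1r. Qed.

Lemma size_all_one_poly (q k : nat) : size (all_one_poly q k) = k.+1.
Proof. by rewrite all_one_polyE size_poly_eq ?oner_neq0. Qed.

(* {poly %/ h} is the quotient by mk_monic h. *)
Lemma mk_monic_all_one_poly (q k : nat) :
  (0 < k)%N -> mk_monic (all_one_poly q k) = all_one_poly q k.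
Proof.
move=> k_gt0; rewrite /mk_monic size_all_one_poly ltnS k_gt0 /=.
by rewrite monicE lead_coefE size_all_one_poly all_one_polyE coef_poly ltnSn eqxx.
Qed.

(* F_{q^k} = F_q[x]/(1 + x + ... + x^k); the elements of {poly %/ h} are the
   polynomials of size at most k (degree < k), with product modulo h. It is the
   quotient as a ring: it is a field exactly when h is irreducible, as when
   k + 1 is prime and q is a primitive root modulo k + 1. *)
Notation Fqk q k := {poly %/ all_one_poly q k}.

Definition phi (q k : nat) (y : Fqk q k) : 'rV['F_q]_k :=
  poly_rV (y : {poly 'F_q}).

Definition wozencraft (q k : nat) (alpha : Fqk q k) :
    {set 'rV['F_q]_(k + k)} :=
  [set row_mx (phi y) (phi (alpha * y)) | y : Fqk q k].

(* The multiplicative order of g modulo m is totient m; meaningful for m > 1,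
   since 'Z_0 and 'Z_1 are Z/2. *)
Definition primitive_root_mod (m g : nat) : bool :=
  (totient m).-primitive_root (g%:R : 'Z_m).

Definition largest_prime_below (R : realType) (x : R) (d : nat) : Prop :=
  [/\ prime d, d%:R < x
    & forall r : nat, prime r -> r%:R < x -> (r <= d)%N].

(* For F of order d^2 with d prime, the subfield F_d of F is the set of the
   images of 0, ..., d - 1. *)
Definition prime_subfield (d : nat) (F : finFieldType) : {set F} :=
  [set (c : nat)%:R | c : 'I_d].

Definition bose_chowla (d : nat) (F : finFieldType) (theta : F) :
    {set 'I_(d ^ 2)} :=
  [set a : 'I_(d ^ 2) | (1 <= a)%N
     && (theta ^+ a - theta \in prime_subfield d F)].

Definition alpha_star (q k d : nat) (A : {set 'I_(d ^ 2)}) : Fqk q k :=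
  \sum_(a in A) 'qX ^+ a.

(* Main.v *)
(**
 Fix y <> 0 and write z = alpha * y. Since (x - 1) p(x) = x^(k+1) - 1 and every
 multiple of p is congruent to a constant times p modulo x^(k+1) - 1, the cyclic
 convolution of y with the indicator of A modulo k + 1 equals z + c p for some
 scalar c. Let s and w be the weights of y and z.
 If c <> 0, the convolution is nonzero wherever z vanishes, so it has weight at
 least k + 1 - w; its weight is at most d s, hence k + 1 <= d s + w, and
 d^2 < k forces s + w >= d / 2.
 If c = 0, then w is the weight of the convolution. A is a Sidon set in the
 integers but not necessarily modulo k + 1; still, two distinct translates of A
 modulo k + 1 meet in at most 2 points, so w >= s (d - 2 (s - 1)), which again
 gives s + w >= d / 2.
 The bound d >= c0 sqrt k is a weak Bertrand postulate, obtained in Chebyshev's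
 way from the factorization of the central binomial coefficients.
*)
Require Import Defs.
From mathcomp Require Import all_boot all_order all_algebra all_fingroup.
From mathcomp Require Import all_solvable all_field.
From mathcomp Require Import reals.
From mathcomp Require Import zify ring lra.
Set Implicit Arguments.
Unset Strict Implicit.
Unset Printing Implicit Defensive.
Import Order.TTheory GRing.Theory Num.Theory.


(** * A weak Bertrand postulate *)

(** By Legendre's formula the exponent is a sum over [k] of [n %/ p ^ k - m %/ p ^ k - (n - m) %/ p
    ^ k]. Each term is at most 1 and vanishes once [p ^ k > n], which leaves at most [trunc_log p n]
    of them. *)
Lemma leq_expn_logn_bin n m p : 0 < n -> prime p -> p ^ logn p 'C(n, m) <= n.
Proof.
move=> n_gt0 p_pr; have p_gt1 := prime_gt1 p_pr.
have [lt_nm | le_mn] := ltnP n m; first by rewrite bin_small // logn0.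
apply: leq_trans (trunc_logP p_gt1 n_gt0); rewrite leq_exp2l //.
set t := trunc_log p n.
have pk_gt0 k : 0 < p ^ k by rewrite expn_gt0 prime_gt0.
have fact_logn i : i <= n -> logn p i`! = \sum_(1 <= k < n.+1) i %/ p ^ k.
  move=> le_in; rewrite logn_fact // [RHS](big_cat_nat (n := i.+1)) //=.
  rewrite [X in _ = _ + X]big_nat_cond [X in _ = _ + X]big1 ?addn0 //.
  move=> k /andP[/andP[lt_ik _] _]; rewrite divn_small //.
  exact: ltn_trans lt_ik (ltn_expl _ p_gt1).
have := congr1 (logn p) (bin_fact le_mn).
rewrite !lognM ?muln_gt0 ?fact_gt0 ?bin_gt0 ?le_mn //.
rewrite !fact_logn ?leq_subr //.
have: \sum_(1 <= k < n.+1) n %/ p ^ k <= \sum_(1 <= k < n.+1) (k <= t)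
   + (\sum_(1 <= k < n.+1) m %/ p ^ k + \sum_(1 <= k < n.+1) (n - m) %/ p ^ k).
  rewrite -!big_split /=; apply: leq_sum => k _.
  have [le_kt | lt_tk] := leqP k t.
    by have := leq_divDl (p ^ k) m (n - m); rewrite subnKC // [_ + 1]addnC.
  rewrite divn_small // (leq_trans (trunc_log_ltn n p_gt1)) //.
  by rewrite leq_exp2l.
have: \sum_(1 <= k < n.+1) (k <= t) <= t.
  elim: (n) t => [|i IHi] t; first by rewrite big_geq.
  rewrite big_nat_recl //; case: t => [|t].
    by rewrite big1.
  by rewrite (leq_add (leqnn 1)) // (leq_trans _ (IHi t)) // big_add1.
lia.
Qed.

Lemma bin_prod_primes n m : 0 < n -> m <= n ->
  'C(n, m) = \prod_(0 <= p < n.+1 | prime p) p ^ logn p 'C(n, m).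
Proof.
move=> n_gt0 le_mn; set c := 'C(n, m).
have c_gt0 : 0 < c by rewrite bin_gt0.
rewrite -{1}(partnT c_gt0) (widen_partn _ (leq_addl n c)).
rewrite (big_cat_nat (n := n.+1)) //= ?ltnS ?leq_addr //.
rewrite [X in _ * X]big_nat_cond [X in _ * X]big1 ?muln1; last first.
  move=> p /andP[/andP[lt_np _] _].
  case p_pr: (prime p); last by rewrite lognE p_pr.
  have := leq_expn_logn_bin m n_gt0 p_pr; rewrite -/c.
  case: (logn p c) => // l; rewrite expnS => le_n.
  have := leq_pmulr p (pfactor_gt0 p 0).
  have: 0 < p ^ l by rewrite expn_gt0 prime_gt0.
  by move=> pl; move: (leq_trans lt_np (leq_pmulr p pl)); rewrite ltnNge le_n.
rewrite [RHS]big_mkcond; apply: eq_bigr => p _.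
by case: ifP => // p_pr; rewrite lognE p_pr.
Qed.

Lemma leq_expn2_bin n : 2 ^ n <= 'C(n.*2, n).
Proof.
elim: n => [|n IHn] //.
have /= := mul_bin_diag n.*2.+2 n; rewrite -doubleS -mul2n -mulnA mulnCA.
move=> /eqP; rewrite eqn_pmul2l // mul2n => /eqP <-.
rewrite expnS mul2n leq_double; apply: leq_trans IHn _.
exact: leq_bin2l.
Qed.

(** Induction by doubling: a prime in (2^j, 2^(j+1)] divides (2^(j+1))! but not (2^j)!, hence
    divides the binomial coefficient C(2^(j+1), 2^j), which is at most 2^(2^(j+1)). *)
Lemma primorial_leq j :
  \prod_(0 <= p < (2 ^ j).+1 | prime p) p <= 2 ^ 2 ^ j.+1.
Proof.
elim: j => [|j IHj].
  by rewrite expn0 unlock.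
have lt2 : 2 ^ j <= 2 ^ j.+1 by rewrite leq_exp2l.
rewrite (big_cat_nat (n := (2 ^ j).+1)) //= [2 ^ j.+2]expnS mul2n -addnn expnD.
apply: leq_mul IHj _.
have c_le : 'C(2 ^ j.+1, 2 ^ j) <= 2 ^ 2 ^ j.+1.
  have := expnDn 1 1 (2 ^ j.+1); rewrite (_ : 1 + 1 = 2) // => ->.
  have lt_j : 2 ^ j < (2 ^ j.+1).+1 by [].
  rewrite (bigD1 (Ordinal lt_j)) //= !exp1n !muln1; exact: leq_addr.
apply: leq_trans c_le; rewrite bin_prod_primes ?expn_gt0 //.
rewrite [leqRHS](big_cat_nat (n := (2 ^ j).+1)) //=.
set B := (X in _ <= _ * X); set A := (X in _ <= X * _).
have A_gt0 : 0 < A.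
  rewrite /A big_mkcond prodn_gt0 // => p.
  by case: ifP => // p_pr; rewrite expn_gt0 prime_gt0.
apply: leq_trans (leq_pmull B A_gt0).
rewrite /B big_nat_cond [leqRHS]big_nat_cond.
apply: leq_prod => p /andP[/andP[lt_jp le_pj] p_pr].
rewrite -{1}(expn1 p) leq_exp2l ?prime_gt1 //.
rewrite logn_gt0 mem_primes p_pr bin_gt0 lt2 /=.
have /= fE := bin_fact lt2.
have: p %| (2 ^ j.+1)`! by rewrite dvdn_fact // prime_gt0.
rewrite -fE (Euclid_dvdM _ _ p_pr) => /orP[//|].
have -> : 2 ^ j.+1 - 2 ^ j = 2 ^ j by rewrite expnS mul2n -addnn addnK.
have nd : ~~ (p %| (2 ^ j)`!).
  rewrite fact_prod Euclid_dvd_prod // big_has_cond -all_predC.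
  apply/allP => i; rewrite mem_index_iota /= => /andP[i_gt0 le_ij].
  by rewrite gtnNdvd //; lia.
by rewrite Euclid_dvdM // (negPf nd).
Qed.

(** Suppose there is no such prime, and factor C(N, N/2) >= 2^(N/2). Primes up to [r], the square
    root of [N], contribute at most [N] each; larger ones have exponent at most 1 and are at most
    [M], so together they contribute at most the primorial of [M]. *)
Lemma prime_between_pow4 h : 3 <= h ->
  exists2 p, prime p & 4 ^ h < p <= 4 ^ h.+2.
Proof.
move=> h_ge3; set N := 4 ^ h.+2; set M := 4 ^ h.
have [/existsP[p /andP[p_pr lt_p]] | no_p] :=
    boolP [exists p : 'I_N.+1, prime p && (M < p)].
  by exists p => //; rewrite lt_p -ltnS ltn_ord.
have pow4 e : 4 ^ e = 2 ^ e.*2 by rewrite -mul2n expnM.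
have N_gt0 : 0 < N by rewrite expn_gt0.
set r := 2 ^ h.+2; set m := 2 ^ h.*2.+3.
have N_double : m.*2 = N by rewrite -mul2n -expnS /N pow4 !doubleS.
have N_sqr : N = r ^ 2 by rewrite /N pow4 -muln2 expnM.
have le_rN : r < N.+1 by rewrite ltnS N_sqr -{1}(expn1 r) leq_pexp2l ?expn_gt0.
have le_mN : m <= N by rewrite -N_double -addnn leq_addr.
have: 2 ^ m <= N ^ r.+1 * 2 ^ 2 ^ h.*2.+1.
  apply: leq_trans (leq_expn2_bin m) _; rewrite N_double bin_prod_primes //.
  apply: leq_trans
    (_ : \prod_(0 <= p < N.+1) ((if p < r.+1 then N else 1)
           * (if prime p && (p < M.+1) then p else 1)) <= _); last first.
    rewrite big_split leq_mul //.
      rewrite -big_mkcond -(big_nat_widen 0 r.+1 N.+1 predT) //.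
      by rewrite prod_nat_const_nat subn0.
    rewrite -big_mkcond -(big_nat_widen 0 M.+1 N.+1 prime).
      by rewrite /M pow4 primorial_leq.
    by rewrite ltnS leq_exp2l // leqW.
  rewrite big_mkcond big_nat_cond [leqRHS]big_nat_cond.
  apply: leq_prod => p /andP[lt_pN _]; case: ifP => [p_pr|_]; last first.
    by rewrite muln1; case: ifP.
  have -> /= : p < M.+1.
    rewrite ltnS leqNgt; apply: contra no_p => lt_Mp; apply/existsP.
    by exists (Ordinal lt_pN) => /=; rewrite p_pr.
  have p_gt0 := prime_gt0 p_pr.
  have := leq_expn_logn_bin m N_gt0 p_pr; set l := logn _ _ => le_pl.
  have [_|lt_rp] := ltnP p r.+1.
    exact: leq_trans le_pl (leq_pmulr _ _).
  rewrite mul1n -{2}(expn1 p) leq_exp2l ?prime_gt1 // leqNgt.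
  apply/negP => l_gt1; have: p ^ 2 <= N.
    by apply: leq_trans le_pl; rewrite leq_pexp2l.
  by rewrite N_sqr leq_exp2r // leqNgt lt_rp.
(* With H = 2^h, comparing exponents of 2 gives 8H^2 <= (2h + 4)(4H + 1) + 2H^2, which fails when 5h
   < 2H and H >= 8. *)
rewrite /N pow4 -expnM -expnD leq_exp2l // /m /r !expnS.
have -> : 2 ^ h.*2 = 2 ^ h * 2 ^ h by rewrite -addnn expnD.
have lt_h : 5 * h < 2 * 2 ^ h.
  rewrite -(subnK h_ge3); elim: (h - 3) => [|i IHi] //.
  by rewrite addSn expnS; lia.
have := leq_pexp2l (isT : 0 < 2) h_ge3; nia.
Qed.

Lemma prime_between_ratio n : 0 < n ->
  exists2 p, prime p & n < p <= 1024 * n.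
Proof.
(* The factor 1024 = 4^5 is dictated by n < 64, where h = 3 gives a prime in (64, 1024]. For larger
   n, with 4^t <= n < 4^(t+1), h = t + 1 gives one up to 4^(t+3) <= 64n. *)
move=> n_gt0; have [lt_n | le_n] := ltnP n 64.
  have [//|p p_pr /andP[lt_p le_p]] := @prime_between_pow4 3.
  by exists p; rewrite // (ltn_trans lt_n) //= (leq_trans le_p) ?leq_pmulr.
have /andP[le_tn lt_nt] := trunc_log_bounds (isT : 1 < 4) n_gt0.
set t := trunc_log 4 n in le_tn lt_nt.
have t_ge3 : 3 <= t by apply: (@trunc_log_max 4 n 3).
have [|p p_pr /andP[lt_p le_p]] := @prime_between_pow4 t.+1; first exact: leqW.
exists p; rewrite // (ltn_trans lt_nt) //= (leq_trans le_p) // !expnS.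
by lia.
Qed.

Local Open Scope ring_scope.

(** * Cyclic convolution with a Sidon set *)

(** Equality of differences a - b = a' - b' in the integers, written with sums to avoid truncated
    subtraction; b = b' follows from a = a'. *)
Definition sidon (m : nat) (A : {set 'I_m}) : Prop :=
  forall a b a' b' : 'I_m, a \in A -> b \in A -> a' \in A -> b' \in A ->
  a != b -> (a + b' = a' + b)%N -> a = a'.

Section CyclicConvolution.

Variables (V : zmodType) (n m : nat) (A : {set 'I_m}) (y : 'I_n -> V).
Hypotheses (n_gt0 : (0 < n)%N) (le_mn : (m <= n)%N).

(** For each [a] exactly one index [i] satisfies the congruence, so the inner sum is the single
    value of [y] at j - a modulo [n]. *)
Definition cyclic_conv (j : 'I_n) : V :=
  \sum_(a in A) \sum_(i < n | (a + i == j %[mod n])%N) y i.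

Let S := [set i | y i != 0].
Let T := [set j | cyclic_conv j != 0].

Lemma eqn_mod_cases (a b : nat) : (a < n.*2)%N -> (b < n.*2)%N ->
  (a = b %[mod n])%N -> [\/ a = b, a = b + n | b = a + n]%N.
Proof.
have modE c : (c < n.*2)%N -> (c %% n = if c < n then c else c - n)%N.
  move=> lt_c; case: ltnP => [/modn_small // | le_nc].
  by rewrite -{1}(subnK le_nc) modnDr modn_small //; lia.
move=> /modE-> /modE->; case: ltnP => ?; case: ltnP => ? eq_ab.
- by apply: Or31; lia.
- by apply: Or33; lia.
- by apply: Or32; lia.
by apply: Or31; lia.
Qed.

Let overlap (i j : 'I_n) : {set 'I_m} :=
  [set a in A | [exists b in A, (a + i == b + j %[mod n])%N]].

(* A nonzero residue mod n lifts to only two integers in (-n, n), one of each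
   sign, and each is represented at most once as a difference. *)
Lemma card_overlap (i j : 'I_n) :
  sidon A -> i != j -> (#|overlap i j| <= 2)%N.
Proof.
move=> sidonA ne_ij.
(* [f] records the sign of a - b for a witness [b]; injectivity into [bool] gives the bound 2. *)
pose f (a : 'I_m) :=
  [exists b in A, (a + i == b + j %[mod n])%N && (b < a)%N].
suff f_inj : {in overlap i j &, injective f}.
  by rewrite -(card_in_imset f_inj) (leq_trans (max_card _)) ?card_bool.
have ne_val : (i : nat) <> j by move/val_inj/eqP; rewrite (negPf ne_ij).
have lt_i := ltn_ord i; have lt_j := ltn_ord j.
have main (a b a' b' : 'I_m) : a \in A -> b \in A -> a' \in A -> b' \in A ->
   (a + i == b + j %[mod n])%N -> (a' + i == b' + j %[mod n])%N ->
   (b < a)%N = (b' < a')%N -> a = a'.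
  move=> aA bA a'A b'A; have ltm (c : 'I_m) := leq_trans (ltn_ord c) le_mn.
  have := (ltm a, ltm b, ltm a', ltm b') => -[[[lta ltb] lta'] ltb'].
  move=> /eqP/eqn_mod_cases cab /eqP/eqn_mod_cases cab' lt_eq.
  have {}cab : [\/ a + i = b + j, a + i = b + j + n | b + j = a + i + n]%N.
    by apply: cab; lia.
  have {}cab' :
      [\/ a' + i = b' + j, a' + i = b' + j + n | b' + j = a' + i + n]%N.
    by apply: cab'; lia.
  apply: (sidonA _ _ _ _ aA bA a'A b'A).
    by apply: contra_not_neq ne_val => eq_ab; subst b; case: cab; lia.
  by case: cab => ?; case: cab' => ?; lia.
move=> a a'; rewrite !inE => /andP[aA /exists_inP[b bA ab]].
move=> /andP[a'A /exists_inP[b' b'A ab']] ff.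
have [/exists_inP[c cA /andP[ac lt_ca]] | nfa] := boolP (f a).
  have /exists_inP[c' c'A /andP[ac' lt_ca']] : f a'.
    by rewrite -ff; apply/exists_inP; exists c; rewrite ?ac.
  by apply: (main a c a' c'); rewrite ?lt_ca ?lt_ca'.
have nfa' : ~~ f a' by rewrite -ff.
apply: (main a b a' b') => //.
have nlt (x z : 'I_m) : z \in A -> (x + i == z + j %[mod n])%N -> ~~ f x ->
    (z < x)%N = false.
  move=> zA xz; apply: contraNF => lt_zx; apply/exists_inP; exists z => //.
  by rewrite xz.
by rewrite (nlt a b) ?(nlt a' b').
Qed.

Lemma card_supp_cyclic_conv_le : (#|T| <= #|A| * #|S|)%N.
Proof.
pose g (p : 'I_m * 'I_n) := Ordinal (ltn_pmod (p.1 + p.2) n_gt0).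
rewrite -cardsX (leq_trans _ (leq_imset_card g _)) // subset_leq_card //.
apply/subsetP => j; rewrite inE; apply: contraR => nim.
rewrite /cyclic_conv big1 // => a aA; rewrite big1 // => i ij.
apply: contraNeq nim => yi; apply/imsetP; exists (a, i).
  by rewrite !inE aA.
by apply/val_inj; rewrite /= (eqP ij) modn_small.
Qed.

(* Each translate of A by a point of S meets the other translates in at most
   2(#|S| - 1) points, and elsewhere the convolution has only one term. *)
Lemma card_supp_cyclic_conv_ge :
  sidon A -> (#|S| * (#|A| - 2 * #|S|.-1) <= #|T|)%N.
Proof.
move=> sidonA.
pose U i := A :\: \bigcup_(j in S :\ i) overlap i j.
pose W := [set p : 'I_n * 'I_m | (p.1 \in S) && (p.2 \in U p.1)].
pose g (p : 'I_n * 'I_m) := Ordinal (ltn_pmod (p.2 + p.1) n_gt0).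
(* A pair in [W] is the only pair of S x A reaching its residue. This gives both the injectivity of
   [g] and the nonvanishing of the convolution there. *)
have uniqW i a j b : (i, a) \in W -> j \in S -> b \in A ->
    (a + i == b + j %[mod n])%N -> (j, b) = (i, a).
  rewrite inE in_setD => /and3P[/= Si nU aA] Sj bA eq_ab.
  have [eq_ji | ne_ji] := eqVneq j i.
    move: eq_ab; rewrite eq_ji eqn_modDr !modn_small ?(leq_trans _ le_mn) //.
    by move/eqP/val_inj => ->.
  case/negP: nU; apply/bigcupP; exists j; first by rewrite in_setD1 ne_ji.
  by rewrite inE aA; apply/exists_inP; exists b.
have cardU i : i \in S -> (#|A| - 2 * #|S|.-1 <= #|U i|)%N.
  move=> Si; rewrite /U cardsD leq_sub2l //.
  apply: leq_trans (subset_leq_card (subsetIr _ _)) _.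
  have -> : #|S|.-1 = #|S :\ i| by rewrite (cardsD1 i S) Si.
  rewrite mulnC -sum_nat_const.
  elim/big_ind2: _ => [|X1 n1 X2 n2 le1 le2|j]; first by rewrite cards0.
    by rewrite (leq_trans (leq_card_setU _ _)) // leq_add.
  rewrite in_setD1 => /andP[ne_ji _].
  by apply: card_overlap; rewrite // eq_sym.
have cardW : (#|S| * (#|A| - 2 * #|S|.-1) <= #|W|)%N.
  have -> : #|W| = (\sum_(i in S) #|U i|)%N.
    rewrite -sum1_card -(eq_bigr _ (fun i _ => sum1_card (mem (U i)))).
    by rewrite pair_big_dep; apply: eq_bigl => p; rewrite inE.
  by rewrite -sum_nat_const; apply: leq_sum.
have g_inj : {in W &, injective g}.
  move=> [i a] [j b] Wia Wjb /(congr1 val) /= /eqP eq_g.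
  have := Wjb; rewrite inE /= => /andP[Sj /setDP[bA _]].
  by rewrite (uniqW _ _ _ _ Wia Sj bA eq_g).
rewrite (leq_trans cardW) // -(card_in_imset g_inj) subset_leq_card //.
apply/subsetP => _ /imsetP[[i a] Wia ->]; rewrite inE.
have := Wia; rewrite inE /= => /andP[Si /setDP[aA _]].
rewrite /cyclic_conv (bigD1 a) //= (bigD1 i) /=; last by rewrite modn_mod.
rewrite big1 ?addr0 => [|j /andP[eq_j ne_ji]]; last first.
  apply: contraNeq ne_ji => yj; have Sj : j \in S by rewrite inE.
  rewrite modn_mod eq_sym in eq_j.
  by have [->] := uniqW _ _ _ _ Wia Sj aA eq_j.
rewrite big1 ?addr0 => [|b /andP[bA ne_ba]]; first by rewrite inE in Si.
rewrite big1 // => j eq_j; apply: contraNeq ne_ba => yj.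
have Sj : j \in S by rewrite inE.
rewrite modn_mod eq_sym in eq_j.
by have [_ ->] := uniqW _ _ _ _ Wia Sj bA eq_j.
Qed.

End CyclicConvolution.

(** * Bose-Chowla sets *)

Section BoseChowla.

Variables (d : nat) (F : finFieldType) (theta : {unit F}).
Hypotheses (d_pr : prime d) (cardF : #|F| = (d ^ 2)%N).
Hypothesis (theta_gen : generator [set: {unit F}] theta).

Let pcharFd : d \in [pchar F] := card_finPcharP cardF d_pr.

Lemma order_primitive_elt : #[theta]%g = (d ^ 2).-1.
Proof. by rewrite -cardF -card_finField_unit (eqP theta_gen). Qed.

Lemma primitive_elt_expr_inj (a b : nat) :
  (0 < a < d ^ 2)%N -> (0 < b < d ^ 2)%N ->
  val theta ^+ a = val theta ^+ b -> a = b.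
Proof.
move=> /andP[a_gt0 lt_a] /andP[b_gt0 lt_b].
rewrite -!FinRing.val_unitX => /val_inj/eqP.
rewrite eq_expg_mod_order order_primitive_elt.
case: a a_gt0 lt_a => // a _ lt_a; case: b b_gt0 lt_b => // b _ lt_b.
by rewrite -[a.+1]addn1 -[b.+1]addn1 eqn_modDr !modn_small; lia.
Qed.

(** This encodes that [theta] lies outside F_d, whose elements are fixed by Frobenius: the exponents
    d and 1 differ and both lie in [1, d^2 - 1]. *)
Lemma primitive_elt_Frobenius : val theta ^+ d != val theta.
Proof.
have d_gt1 := prime_gt1 d_pr.
rewrite -[eqbRHS]expr1; apply/eqP => /primitive_elt_expr_inj eq_d1.
suff: d = 1%N by lia.
by apply: eq_d1; rewrite -mulnn; nia.
Qed.

Lemma prime_subfield_Frobenius u : u \in prime_subfield d F -> u ^+ d = u.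
Proof.
by case/imsetP => c _ ->; rewrite -(pFrobenius_autE pcharFd) rmorph_nat.
Qed.

Lemma card_prime_subfield : #|prime_subfield d F| = d.
Proof.
rewrite card_imset ?card_ord // => c e.
wlog le_ce : c e / (c <= e)%N => [IH | /esym/eqP].
  by case: (leqP c e) => [/IH //|/ltnW/IH eq_ce /esym/eq_ce].
rewrite -subr_eq0 -natrB // -(dvdn_pcharf pcharFd) => /dvdn_leq le_d.
apply/val_inj => /=; have := ltn_ord e.
by case: (posnP (e - c)%N) => [|/le_d]; lia.
Qed.

(** The map sending [a] to theta^a - theta is a bijection onto F_d. It is onto because u + theta is
    nonzero for u in F_d, hence a power of [theta]. *)
Lemma card_bose_chowla : #|bose_chowla d (val theta)| = d.
Proof.
have d_gt1 := prime_gt1 d_pr.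
set A := bose_chowla _ _.
rewrite -[RHS]card_prime_subfield.
have f_inj :
    {in A &, injective (fun a : 'I_(d ^ 2) => val theta ^+ a - val theta)}.
  move=> a b; rewrite !inE => /andP[a_gt0 _] /andP[b_gt0 _].
  move/(congr1 (+%R^~ (val theta))); rewrite !subrK.
  move=> /primitive_elt_expr_inj eq_ab; apply/val_inj/eq_ab.
    by rewrite a_gt0 /=.
  by rewrite b_gt0 /=.
rewrite -(card_in_imset f_inj); apply: eq_card => u; apply/imsetP/idP.
  by case=> a; rewrite inE => /andP[_ uP] ->.
move=> uF; have nz : u + val theta \is a GRing.unit.
  rewrite unitfE addr_eq0; apply: contraNneq primitive_elt_Frobenius => u_th.
  have := prime_subfield_Frobenius uF.
  rewrite -(pFrobenius_autE pcharFd u) u_th pFrobenius_autN pFrobenius_autE.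
  by move/oppr_inj/eqP.
have: FinRing.unit F nz \in <[theta]>%g by rewrite -(eqP theta_gen) inE.
case/cycleP => i /(congr1 val); rewrite FinRing.val_unitX /= => u_i.
set o := (d ^ 2).-1.
have o_gt0 : (0 < o)%N by rewrite /o -mulnn; nia.
(* Exponents in the set start at 1, so the residue 0 is represented by the group order [o]. *)
set j := if (i %% o == 0)%N then o else (i %% o)%N.
have j_bd : (0 < j < d ^ 2)%N.
  have oE : (d ^ 2)%N = o.+1 by rewrite prednK // expn_gt0 prime_gt0.
  rewrite /j oE; have := ltn_pmod i o_gt0.
  case: eqP => [_ _|/eqP r_nz lt_r]; first by rewrite o_gt0 ltnSn.
  by rewrite lt0n r_nz ltnS ltnW.
have j_u : val theta ^+ j = u + val theta.
  rewrite u_i -!FinRing.val_unitX; congr (val _); apply/eqP.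
  rewrite eq_expg_mod_order order_primitive_elt -/o /j.
  by case: ((i %% o)%N =P 0%N) => [->|_]; rewrite ?modnn ?modn_mod.
have /andP[j_gt0 lt_j] := j_bd.
exists (Ordinal lt_j); last by rewrite /= j_u addrK.
by rewrite inE /= j_gt0 j_u addrK.
Qed.

(* With theta^a = theta + u etc., the difference of the two products
   (theta + u)(theta + v') and (theta + u')(theta + v) is linear in theta, so it
   vanishes identically because theta is not in F_d. *)
Lemma bose_chowla_sidon : sidon (bose_chowla d (val theta)).
Proof.
move=> a b a' b'; rewrite !inE.
move=> /andP[a_gt0 +] /andP[b_gt0 +] /andP[a'_gt0 +] /andP[b'_gt0 +].
set t := val theta; set u := t ^+ a - t; set v := t ^+ b - t.
set u' := t ^+ a' - t; set v' := t ^+ b' - t.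
move=> /prime_subfield_Frobenius uP /prime_subfield_Frobenius vP.
move=> /prime_subfield_Frobenius u'P /prime_subfield_Frobenius v'P ne_ab eqD.
have fE x y : t ^+ x - t = t ^+ y - t -> t ^+ x = t ^+ y.
  by move/(congr1 (+%R^~ t)); rewrite !subrK.
suff: u = u'.
  by move/fE/primitive_elt_expr_inj => eq_a; apply/val_inj/eq_a; apply/andP.
have ne_uv : u - v != 0.
  rewrite subr_eq0; apply: contraNneq ne_ab => /fE/primitive_elt_expr_inj eq_a.
  by apply/eqP/val_inj/eq_a; apply/andP.
have: (t + u) * (t + v') = (t + u') * (t + v).
  by rewrite /u /v /u' /v' ![t + _]addrC !subrK -!exprD eqD.
move: u v u' v' uP vP u'P v'P ne_uv {fE} => u v u' v' uP vP u'P v'P ne_uv eqM.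
set e := u + v' - u' - v; set f := u' * v - u * v'.
have ef : e * t = f.
  apply/eqP; rewrite -subr_eq0; move/eqP: eqM; rewrite -subr_eq0.
  by congr (_ == 0); rewrite /e /f; ring.
have e0 : e = 0.
  apply/eqP; apply: contraTT isT => e_nz.
  have := primitive_elt_Frobenius; rewrite -/t.
  have -> : t = f / e by rewrite -ef mulrAC divff ?mul1r.
  rewrite -(pFrobenius_autE pcharFd) fmorph_div /e /f.
  rewrite !(rmorphB, rmorphD, rmorphM) /= !pFrobenius_autE.
  by rewrite uP vP u'P v'P eqxx.
have f0 : f = 0 by rewrite -ef e0 mul0r.
apply/eqP; rewrite -subr_eq0.
(* Up to sign, this evaluates (X + u)(X + v') - (X + u')(X + v) = eX - f at X = -u. *)
have: (u - u') * (u - v) = u * e + f by rewrite /e /f; ring.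
by rewrite e0 f0 mulr0 addr0 => /eqP; rewrite mulf_eq0 (negPf ne_uv) orbF.
Qed.

End BoseChowla.

(** * The Wozencraft code of a Sidon set *)

Lemma modp_XnXnsub1 (F : fieldType) (n m : nat) : (0 < n)%N ->
  ('X^m : {poly F}) %% ('X^n - 1) = 'X^(m %% n).
Proof.
move=> n_gt0; apply/eqP; rewrite -subr_eq0 -polyC1.
rewrite -[X in _ - X](@modp_small _ _ ('X^n - 1%:P)); last first.
  by rewrite size_XnsubC // size_polyXn ltnS ltn_pmod.
rewrite -modpN -modpD polyC1; apply/eqP/modp_eq0.
have -> : 'X^m - 'X^(m %% n)
    = ('X^(n * (m %/ n)) - 1) * 'X^(m %% n) :> {poly F}.
  by rewrite mulrBl mul1r -exprD [(n * _)%N]mulnC -divn_eq.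
apply: dvdp_mulr; apply/dvdpP; exists (\sum_(i < m %/ n) 'X^n ^+ i).
by rewrite exprM subrX1 mulrC.
Qed.

(** Write r = r(1) + r1 (X - 1); the second term dies because (X - 1) times the all-one polynomial
    is X^(k+1) - 1. *)
Lemma modp_all_one_Xnsub1 (q k : nat) (r : {poly 'F_q}) :
  (r * all_one_poly q k) %% ('X^(k.+1) - 1) = r.[1] *: all_one_poly q k.
Proof.
have mulX : ('X - 1) * all_one_poly q k = 'X^(k.+1) - 1 by rewrite subrX1.
have [r1 r_eq] : exists r1, r - r.[1]%:P = r1 * ('X - 1).
  by apply/factor_theorem; rewrite /root !hornerE subrr.
rewrite -[r in LHS](subrK r.[1]%:P) r_eq mulrDl -mulrA mulX modpD modp_mull.
rewrite add0r mul_polyC modp_small // -polyC1 size_XnsubC //.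
by rewrite (leq_ltn_trans (size_scale_leq _ _)) ?size_all_one_poly.
Qed.

Lemma cyclic_convE (F : fieldType) (n m : nat) (A : {set 'I_m}) (p : {poly F})
    (j : 'I_n) : (size p <= n)%N ->
  (((\sum_(a in A) 'X^a) * p) %% ('X^n - 1))`_j
    = cyclic_conv A (fun i : 'I_n => p`_i) j.
Proof.
move=> le_pn; have n_gt0 : (0 < n)%N := leq_ltn_trans (leq0n j) (ltn_ord j).
have -> : p = \sum_(i < n) p`_i *: 'X^i.
  rewrite -poly_def; apply/polyP => i; rewrite coef_poly.
  by case: ltnP => // le_ni; rewrite nth_default // (leq_trans le_pn).
have modp_sum (I : finType) (P : pred I) (f : I -> {poly F}) (g : {poly F}) :
    (\sum_(i | P i) f i) %% g = \sum_(i | P i) (f i %% g).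
  by apply: (big_morph (fun x => x %% g)) => [x y|]; rewrite ?modpD ?mod0p.
rewrite mulr_suml modp_sum coef_sum; apply: eq_bigr => a _.
rewrite mulr_sumr modp_sum coef_sum [RHS]big_mkcond; apply: eq_bigr => i _.
rewrite -scalerAr -exprD modpZl modp_XnXnsub1 // coefZ coefXn.
rewrite -poly_def coef_poly ltn_ord (modn_small (ltn_ord j)) eq_sym.
by case: eqP => _; rewrite ?mulr1 ?mulr0.
Qed.

Definition coef_weight (R : nzSemiRingType) (k : nat) (p : {poly R}) : nat :=
  #|[set i : 'I_k | p`_i != 0]|.

(** Passes from the k coordinates of a codeword half to the k + 1 positions of the convolution. *)
Lemma coef_weight_size (R : nzSemiRingType) (k : nat) (p : {poly R}) :
  (size p <= k)%N -> coef_weight k.+1 p = coef_weight k p.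
Proof.
move=> le_pk; rewrite /coef_weight -!sum1dep_card big_mkcond big_ord_recr /=.
by rewrite (nth_default _ le_pk) eqxx addn0 -big_mkcond.
Qed.

Lemma hamming_dist_row_mx (T : eqType) (m n : nat) (u u' : 'rV[T]_m)
    (v v' : 'rV[T]_n) :
  hamming_dist (row_mx u v) (row_mx u' v')
    = (hamming_dist u u' + hamming_dist v v')%N.
Proof.
rewrite /hamming_dist -!sum1dep_card big_mkcond big_split_ord /=.
by congr addn; rewrite [RHS]big_mkcond; apply: eq_bigr => i _;
  rewrite ?row_mxEl ?row_mxEr.
Qed.

Lemma hamming_dist_phi (q k : nat) (y z : Fqk q k) :
  hamming_dist (phi y) (phi z)
    = coef_weight k (y - z : Fqk q k).
Proof.
have subE : (y - z : Fqk q k) = (y : {poly 'F_q}) - z :> {poly 'F_q} by [].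
by apply: eq_card => i; rewrite !inE /phi !mxE subE coefB subr_eq0.
Qed.

Lemma leq_min_dist (T : finType) (n m : nat) (C : {set 'rV[T]_n}) :
    (m <= n)%N ->
    (forall u v, u \in C -> v \in C -> u != v -> (m <= hamming_dist u v)%N) ->
  (m <= min_dist C)%N.
Proof.
move=> le_mn le_dist; rewrite /min_dist.
elim/big_ind: _ => // [m1 m2 le1 le2 | [u v] /=]; first by rewrite leq_min le1.
by rewrite in_setX => /andP[/andP[uC vC]]; apply: le_dist.
Qed.

Lemma size_Fqk (q k : nat) (y : Fqk q k) : (0 < k)%N ->
  (size (y : {poly 'F_q}) <= k)%N.
Proof.
move=> k_gt0; have hE : (size (mk_monic (all_one_poly q k))).-1 = k.
  by rewrite mk_monic_all_one_poly // size_all_one_poly.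
by rewrite -[leqRHS]hE size_npoly.
Qed.

(** Lifts the product in the quotient to F_q[x], where it can be reduced modulo X^(k+1) - 1
    instead. *)
Lemma alpha_star_mul (q k d : nat) (A : {set 'I_(d ^ 2)}) (y : Fqk q k) :
    (0 < k)%N ->
  exists r : {poly 'F_q}, (\sum_(a in A) 'X^a) * (y : {poly 'F_q})
    = r * all_one_poly q k + (alpha_star q k A * y : Fqk q k).
Proof.
move=> k_gt0; set h := all_one_poly q k; set p := _ * _.
have hE : mk_monic h = h by apply: mk_monic_all_one_poly.
have h_monic : h \is monic by rewrite -hE monic_mk_monic.
exists (Pdiv.Ring.rdivp p h).
suff -> : (alpha_star q k A * y : Fqk q k) = in_qpoly h p.
  by rewrite /= hE; apply: Pdiv.RingMonic.rdivp_eq.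
rewrite /p in_qpolyM; congr (_ * _).
  rewrite /alpha_star raddf_sum; apply: eq_bigr => a _.
  by rewrite [RHS](rmorphXn (in_qpoly h)).
by apply/val_inj; rewrite /= Pdiv.Ring.rmodp_small // size_mk_monic.
Qed.

Lemma weight_alpha_star (q k d : nat) (A : {set 'I_(d ^ 2)}) (y : Fqk q k) :
    (d ^ 2 < k)%N -> #|A| = d -> sidon A -> y != 0 ->
  (d <= 2 * (coef_weight k (y : {poly 'F_q})
     + coef_weight k (alpha_star q k A * y : Fqk q k)))%N.
Proof.
move=> lt_dk cardA sidonA y_nz.
have k_gt0 : (0 < k)%N by apply: leq_trans lt_dk.
have [r p_eq] := alpha_star_mul A y k_gt0.
set z := alpha_star q k A * y in p_eq *.
have le_yk := size_Fqk y k_gt0; have le_zk := size_Fqk z k_gt0.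
rewrite -(coef_weight_size le_yk) -(coef_weight_size le_zk) /coef_weight.
pose f (i : 'I_k.+1) := (y : {poly 'F_q})`_i.
have convE (j : 'I_k.+1) : cyclic_conv A f j = r.[1] + (z : {poly 'F_q})`_j.
  rewrite -cyclic_convE ?leqW // p_eq modpD modp_all_one_Xnsub1.
  have p_j : (all_one_poly q k)`_j = 1.
    by rewrite all_one_polyE coef_poly ltn_ord.
  rewrite coefD coefZ p_j mulr1 modp_small //.
  by rewrite -polyC1 size_XnsubC // ltnS leqW.
have le_dk : (d ^ 2 <= k.+1)%N by rewrite leqW // ltnW.
have := card_supp_cyclic_conv_le A f (ltn0Sn k).
have := card_supp_cyclic_conv_ge f (ltn0Sn k) le_dk sidonA.
rewrite cardA /f; rewrite {}/f in convE.
set S := [set i : 'I_k.+1 | (y : {poly 'F_q})`_i != 0].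
set Z := [set i : 'I_k.+1 | (z : {poly 'F_q})`_i != 0].
set T := [set j | cyclic_conv _ _ _ != 0].
have S_gt0 : (0 < #|S|)%N.
  rewrite card_gt0; apply: contraNneq y_nz => S0; apply/eqP/val_inj/polyP => i.
  rewrite coef0; have [lt_ik | le_ki] := ltnP i k.+1; last first.
    by rewrite nth_default // (leq_trans le_yk) ?(ltnW le_ki).
  by apply/eqP; have := in_set0 (Ordinal lt_ik); rewrite -S0 inE => /negbFE.
have [r0 | r_nz] := eqVneq r.[1] 0.
  have -> : T = Z by apply/setP => j; rewrite !inE convE r0 add0r.
  (* If 2s < d, then s >= 1 gives w >= d - 2s + 2, which suffices; otherwise s alone does. *)
  by nia.
have : (k.+1 <= #|T| + #|Z|)%N.
  rewrite -[k.+1 in leqLHS]card_ord -cardsT.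
  apply: leq_trans (leq_card_setU T Z); apply/subset_leq_card/subsetP => j _.
  by rewrite !inE convE orbC; case: eqP => //= ->; rewrite addr0.
(* If 2(s + w) < d, then d s + w would be below d^2, against k + 1 <= d s + w. *)
by move: lt_dk; rewrite -mulnn; nia.
Qed.

Lemma min_dist_wozencraft_sidon (q k d : nat) (A : {set 'I_(d ^ 2)}) :
    (d ^ 2 < k)%N -> #|A| = d -> sidon A ->
  (d <= 2 * min_dist (wozencraft (alpha_star q k A)))%N.
Proof.
move=> lt_dk cardA sidonA.
suff: (uphalf d <= min_dist (wozencraft (alpha_star q k A)))%N by lia.
(* The first goal, [uphalf d <= k + k], handles the default value of [min_dist]. *)
apply: leq_min_dist => [|u v]; first by move: lt_dk; rewrite -mulnn; nia.
move=> /imsetP[y _ ->] /imsetP[y' _ ->] ne_uv.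
rewrite hamming_dist_row_mx !hamming_dist_phi -[_ * y - _]mulrBr.
rewrite leq_uphalf_double -mul2n; apply: weight_alpha_star => //.
by rewrite subr_eq0; apply: contraNneq ne_uv => ->.
Qed.

Theorem theorem3p1 (R : realType) :
  exists2 c0 : R, 0 < c0 &
    forall q k d : nat,
      prime q -> (4 < k)%N -> prime k.+1 -> primitive_root_mod k.+1 q ->
      largest_prime_below (Num.sqrt (k%:R : R)) d ->
      (forall (F : finFieldType) (theta : {unit F}),
         #|F| = (d ^ 2)%N -> generator [set: {unit F}] theta ->
         (d%:R / 2 : R) <=
           (min_dist (wozencraft
              (alpha_star q k (bose_chowla d (val theta)))))%:R)
      /\ c0 * Num.sqrt k%:R <= d%:R / 2.
Proof.
(* 2048 = 2 * 1024: a prime [r] in (d, 1024d] is at least sqrt k by maximality of [d], so sqrt k <=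
   1024d. *)
exists (2048^-1) => [|q k d _ k_gt4 _ _ [d_pr lt_dk d_max]].
  by rewrite invr_gt0 ltr0n.
split=> [F theta cardF theta_gen|].
  have lt_d2k : (d ^ 2 < k)%N.
    rewrite -(ltr_nat R) natrX -[ltRHS]sqr_sqrtr ?ler0n //.
    by rewrite ltr_pXn2r ?nnegrE ?ler0n ?sqrtr_ge0.
  rewrite ler_pdivrMr ?ltr0n // -natrM ler_nat mulnC.
  apply: min_dist_wozencraft_sidon => //; first exact: card_bose_chowla.
  exact: bose_chowla_sidon.
have [r r_pr /andP[lt_dr le_r]] := prime_between_ratio (prime_gt0 d_pr).
have le_kr : Num.sqrt (k%:R : R) <= r%:R.
  by rewrite leNgt; apply/negP => /(d_max r r_pr); rewrite leqNgt lt_dr.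
have : (r%:R : R) <= 1024 * d%:R by rewrite -natrM ler_nat.
by lra.
Qed.
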